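(* Let $r,s,\alpha,\Delta$ be positive integers with $r>s$, and let $\varepsilon>0$. Then there exists a constant $C>0$ (depending only on $r,s,\alpha,\Delta,\varepsilon$) such that the following holds. Let $\mathcal F$ be a $\Delta$-bounded family of graphs such that for every integer $i\ge 1$ there is a bipartite graph $F\in\mathcal F$ with $\varepsilon i\le |V(F)|\le i$. Then for every $n\in\mathbb N$, $$c_{r,s,\alpha}(n,\mathcal F)\ \le\ C\,n^{1/\chi}+c_{r,r,\alpha}(n,\mathcal F),$$ where $\chi=\chi(\mathcal{KG}^{(\alpha+1)}(r,r-s))$ is the chromatic number of the Kneser hypergraph $\mathcal{KG}^{(\alpha+1)}(r,r-s)$.
   Context: All graphs are finite and simple; $[r]=\{1,\dots,r\}$. An $r$-colouring of the edges of a graph $G$ is an arbitrary map $E(G)\to[r]$. A family $\mathcal F$ of graphs is $\Delta$-bounded if every graph in $\mathcal F$ has maximum degree at most $\Delta$. A subgraph (not necessarily induced) of an edge-coloured graph is monochromatic if all its edges have the same colour. Subgraphs without edges are monochromatic and use no colour. A monochromatic $\mathcal F$-covering of an edge-coloured graph $G$ is a collection $\mathbf S$ of monochromatic subgraphs of $G$, each isomorphic to a graph in $\mathcal F$, such that every vertex of $G$ belongs to at least one subgraph in $\mathbf S$ (the subgraphs need not be disjoint). $|\mathbf S|$ is the number of subgraphs in the collection, and $\mathrm{col}(\mathbf S)$ is the total number of different colours appearing on edges of subgraphs in $\mathbf S$. For a graph $G$ and positive integers $r,s$ (here $s=r$ is allowed), $c_{r,s}(G,\mathcal F)$ is the smallest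 number $k$ such that every $r$-colouring of the edges of $G$ admits a monochromatic $\mathcal F$-covering $\mathbf S$ with $|\mathbf S|\le k$ and $\mathrm{col}(\mathbf S)\le s$. Further, $$c_{r,s,\alpha}(n,\mathcal F)=\max\{c_{r,s}(G,\mathcal F): |V(G)|=n,\ \alpha(G)\le\alpha\},$$ where $\alpha(G)$ is the independence number of $G$. The Kneser hypergraph $\mathcal{KG}^{(\alpha+1)}(r,r-s)$ is the $(\alpha+1)$-uniform hypergraph with vertex set $\{X\subseteq[r]:|X|=r-s\}$ in which vertices $X_1,\dots,X_{\alpha+1}$ form a hyperedge if and only if they are pairwise disjoint as subsets of $[r]$. The chromatic number of a hypergraph is the least number of colours in a vertex colouring with no hyperedge having all its vertices of the same colour (so it equals $1$ if there are no hyperedges). *)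

(* Defs.v *)
From HB Require Import structures.
From mathcomp Require Import all_boot all_order all_algebra.
From mathcomp Require Import boolp classical_sets reals ereal exp.

Set Implicit Arguments.
Unset Strict Implicit.
Unset Printing Implicit Defensive.

Import Order.TTheory GRing.Theory Num.Theory.
Local Open Scope nat_scope.

(** * Finite simple graphs *)

Record sgraph := SGraph {
  svertex :> finType;
  sadj : rel svertex;
  sadj_sym : symmetric sadj;
  sadj_irr : irreflexive sadj }.

Definition edges (G : sgraph) : {set {set G}} :=
  [set [set p.1; p.2] | p in [pred p : G * G | sadj p.1 p.2]].

Definition bipartite (G : sgraph) : Prop :=
  exists side : G -> bool, forall x y : G, sadj x y -> side x != side y.

Definition max_degree (G : sgraph) : nat :=
  \max_(x : G) #|[set y : G | sadj x y]|.

Definition independent (G : sgraph) (A : {set G}) : bool :=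
  [forall x in A, forall y in A, ~~ sadj x y].

Definition independence_number (G : sgraph) : nat :=
  \max_(A : {set G} | independent A) #|A|.

Definition bounded_family (Delta : nat) (F : sgraph -> Prop) : Prop :=
  forall H : sgraph, F H -> max_degree H <= Delta.

(** * Monochromatic coverings *)

(** A subgraph of [G], not necessarily induced, is the pair of its vertex set
    and its edge set. *)
Definition subgraph_data (G : sgraph) : finType :=
  ({set G} * {set {set G}})%type.

Definition is_subgraph (G : sgraph) (S : subgraph_data G) : bool :=
  (S.2 \subset edges G) && [forall e in S.2, e \subset S.1].

(** For a subgraph [S], [f] is an isomorphism from [H] onto [S], seen as a map
    into the vertices of [G]. *)
Definition isomorphic_to_subgraph (H G : sgraph) (S : subgraph_data G) : Prop :=
  exists f : H -> G,
    [/\ injective f,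
        f @: [set: H] = S.1 &
        forall x y : H, sadj x y = ([set f x; f y] \in S.2)].

Section Coverings.
Variables (r : nat) (G : sgraph).

(** An [r]-colouring of the edges is given by a map defined on all vertex sets,
    of which only the values on [edges G] are ever used; for [0 < r] every map
    from the edges to the colours arises in this way. *)
Variable phi : {set G} -> 'I_r.

Definition monochromatic (S : subgraph_data G) : Prop :=
  forall e e' : {set G}, e \in S.2 -> e' \in S.2 -> phi e = phi e'.

Definition mono_covering (F : sgraph -> Prop) (SS : {set subgraph_data G})
    : Prop :=
  (forall S, S \in SS ->
     [/\ is_subgraph S,
         monochromatic S &
         exists2 H : sgraph, F H & isomorphic_to_subgraph H S]) /\
  (forall x : G, exists2 S, S \in SS & x \in S.1).

Definition used_colours (SS : {set subgraph_data G}) : {set 'I_r} :=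
  [set phi e | e in \bigcup_(S in SS) S.2].

End Coverings.

Definition covering_bound (r s : nat) (G : sgraph) (F : sgraph -> Prop)
    (k : nat) : Prop :=
  forall phi : {set G} -> 'I_r,
    exists SS : {set subgraph_data G},
      [/\ mono_covering phi F SS, #|SS| <= k & #|used_colours phi SS| <= s].

(** The covering numbers are extended reals, so that [c_{r,s}(G, F)] is [+oo]
    when no number of subgraphs suffices; otherwise the infimum is a minimum
    (see [cover_numP]). *)
Definition cover_num (R : realType) (r s : nat) (G : sgraph)
    (F : sgraph -> Prop) : \bar R :=
  ereal_inf [set (k%:R%:E : \bar R) | k in [set k | covering_bound r s G F k]].

Lemma cover_numP (R : realType) (r s : nat) (G : sgraph)
    (F : sgraph -> Prop) (k : nat) :
  covering_bound r s G F k ->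
  exists m : nat, [/\ cover_num R r s G F = m%:R%:E,
    covering_bound r s G F m &
    forall j, covering_bound r s G F j -> m <= j].
Proof.
move=> hk.
have ex : exists m, `[< covering_bound r s G F m >] by exists k; apply/asboolP.
case: (ex_minnP ex) => m /asboolP hm mmin.
have {}mmin j : covering_bound r s G F j -> m <= j by move/asboolP; exact: mmin.
exists m; split=> //; apply/eqP; rewrite eq_le; apply/andP; split.
  by apply: ereal_inf_lbound; exists m.
apply: le_ereal_inf_tmp => _ [j hj <-].
by rewrite lee_fin ler_nat mmin.
Qed.

(** Up to isomorphism there are finitely many graphs on [n] vertices, so the
    supremum is a maximum. *)
Definition cover_num_max (R : realType) (r s alpha n : nat)
    (F : sgraph -> Prop) : \bar R :=
  ereal_sup [set c : \bar R | exists G : sgraph,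
    [/\ #|G| = n, independence_number G <= alpha & c = cover_num R r s G F]].

(** * Kneser hypergraphs and their chromatic number *)

Section Hypergraphs.
Variables (T : finType) (E : {set {set T}}).

Definition hyper_proper k (f : {ffun T -> 'I_k}) : bool :=
  [forall e in E, ~~ [forall x in e, forall y in e, f x == f y]].

Definition hyper_colourable k : bool :=
  [exists f : {ffun T -> 'I_k}, hyper_proper f].

(** If all hyperedges have at least two vertices, then [#|T|] colours suffice,
    so the least number of colours can be searched for up to [#|T|]. *)
Definition hyper_chromatic : nat :=
  \big[minn/#|T|]_(k < #|T|.+1 | hyper_colourable k) k.

End Hypergraphs.

Definition kneser_vertex (r m : nat) : finType :=
  {X : {set 'I_r} | #|X| == m}.

(** For [0 < m], vertices that are pairwise disjoint as sets are distinct, so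
    a hyperedge of the [k]-uniform Kneser hypergraph is a set of exactly [k]
    vertices. *)
Definition kneser_hyperedges (k r m : nat) : {set {set kneser_vertex r m}} :=
  [set e : {set kneser_vertex r m} | (#|e| == k) &&
    [forall X in e, forall Y in e, (X != Y) ==> [disjoint val X & val Y]]].

Definition kneser_chromatic (k r m : nat) : nat :=
  hyper_chromatic (kneser_hyperedges k r m).

(* Main.v *)
Require Import Defs.
From HB Require Import structures.
From mathcomp Require Import all_boot all_order all_algebra.
From mathcomp Require Import boolp classical_sets reals ereal exp.
From mathcomp Require Import fintype finset zify.

Set Implicit Arguments.
Unset Strict Implicit.
Unset Printing Implicit Defensive.

Import Order.TTheory GRing.Theory Num.Theory.
Local Open Scope nat_scope.

(** Since covering numbers are nonnegative, it suffices to prove the stronger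
    bound [c_{r,s,alpha}(n, F) <= C n^(1/chi)].  So fix a colouring of a graph
    [G] on [n] vertices with independence number at most [alpha], and let [a]
    be [n^(1/chi)] rounded up.

    For each set [X] of [r - s] colours, try to cover [G] with pieces that
    avoid the colours in [X] (so that at most [s] colours are used), always
    choosing a piece that covers as many new vertices as possible.  As long as
    there are pieces covering at least [a^j] new vertices, [O(a)] steps reduce
    an uncovered set of size [O(a^(j+1))] to one of size [O(a^j)], and once
    [O(a)] vertices are left they are covered by single vertices.  Hence either
    some [X] yields a covering by [O(a)] pieces, or every [X] is stuck at some
    scale [1 <= i < chi]: there is a set [W_X] much larger than [a^i] of which
    no piece avoiding [X] covers [a^i] vertices ([multiscale_cover]).

    In the second case colour the vertex [X] of the Kneser hypergraph by its
    scale.  As only [chi - 1] scales exist, some pairwise disjoint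
    [X_0, ..., X_alpha] are stuck at the same scale [i]
    ([few_colours_covering]).  The sets [W_{X_0}, ..., W_{X_alpha}] cannot have
    an independent transversal, so two of them span a positive proportion of
    all pairs as edges ([sparse_transversal]), and even as edges of a single
    colour [c].  A dense pair contains every bipartite graph of bounded degree
    and of size a small proportion of the pair
    ([bipartite_copy_in_dense_pair]).  As [X_j] and [X_k] are disjoint, [c] is
    missing from one of them, say [X_j]; placing the larger side of the
    bipartite graph into [W_{X_j}] gives a piece avoiding [X_j] that covers
    [a^i] vertices of [W_{X_j}], a contradiction ([no_stuck_hyperedge]).

    The embedding into a dense pair [(A, B)] is a form of dependent random
    choice, where a single random vertex is enough because no attempt is made
    at good constants: for a typical [a] in [A], most [Delta]-tuples in the
    neighbourhood [U] of [a] in [B] have many common neighbours, since a tuple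
    with few common neighbours lies in few neighbourhoods.  One side of the
    bipartite graph is then embedded greedily into [U] and the other side into
    the common neighbourhoods. *)

(** * Neighbourhoods and injections *)

Definition common_nbrs (T : finType) (e : rel T) (A : {set T}) (w : seq T) :=
  [set a in A | all (e a) w].

Definition nbrs_in (T : finType) (e : rel T) (B : {set T}) (a : T) :=
  [set b in B | e a b].

Definition pairs_between (T : finType) (e : rel T) (A B : {set T}) :=
  \sum_(a in A) #|nbrs_in e B a|.

Lemma card_bigcup_le (I T : finType) (P : pred I) (F : I -> {set T}) :
  #|\bigcup_(i | P i) F i| <= \sum_(i | P i) #|F i|.
Proof.
elim/big_rec2: _ => [|i X n _ leXn]; first by rewrite cards0.
by apply: leq_trans (leq_card_setU _ _) _; rewrite leq_add2l.
Qed.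

Lemma subset_of_card (T : finType) (A : {set T}) m :
  m <= #|A| -> exists2 B : {set T}, B \subset A & #|B| = m.
Proof.
case/card_geqP => t [ut szt sub]; exists [set x in t].
  by apply/subsetP => x; rewrite inE => /sub.
by rewrite cardsE (card_uniqP ut).
Qed.

(** When the candidate set of every unassigned element is at least as large as
    the whole domain, values can be chosen one after the other. *)
Lemma injective_extension (H T : finType) (C : H -> {set T}) (D : {set H})
    (g0 : H -> T) :
  {in D &, injective g0} -> (forall q, q \notin D -> #|H| <= #|C q|) ->
  exists g, [/\ injective g, {in D, g =1 g0} &
                forall q, q \notin D -> g q \in C q].
Proof.
move: {2}#|~: D| (leqnn #|~: D|) => n.
elim: n D g0 => [|n IHn] D g0 leDn injg0 largeC.
  move: leDn; rewrite leqn0 cards_eq0 => /eqP/(congr1 (@setC H)).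
  rewrite setCK setC0 => DT; rewrite {}DT in injg0 *.
  by exists g0; split=> [x y| |q]; [exact: injg0 | by [] | rewrite inE].
have [D_full|[q qD]] : ~: D = set0 \/ exists q, q \in ~: D.
  by case: (set_0Vmem (~: D)) => [->|[q]]; [left | right; exists q].
  apply: IHn => //; by rewrite D_full cards0.
have qDF := qD; rewrite inE in qDF.
have [v vC vD] : exists2 v, v \in C q & v \notin g0 @: D.
  apply/subsetPn/negP => /subset_leq_card; apply/negP; rewrite -ltnNge.
  apply: leq_ltn_trans (leq_imset_card _ _) _; apply: leq_trans (largeC q qDF).
  by rewrite -(cardsC D) -addn1 leq_add2l card_gt0; apply/set0Pn; exists q.
pose g1 x := if x == q then v else g0 x.
have g1E : {in D, g1 =1 g0}.
  by move=> x xD; rewrite /g1; case: eqP => // xq; rewrite -xq xD in qDF.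
have [|||g [injg gE gC]] := IHn (q |: D) g1.
- have : #|~: (q |: D)| < #|~: D|; last by lia.
  rewrite proper_card // setCU; apply/properP; split; first exact: subsetIr.
  by exists q; rewrite // !inE eqxx.
- move=> x y; rewrite !inE => /orP[/eqP->|xD] /orP[/eqP->|yD] //.
  + by rewrite (g1E y) // /g1 eqxx => vg; rewrite vg imset_f in vD.
  + by rewrite (g1E x) // /g1 eqxx => vg; rewrite -vg imset_f in vD.
  + by rewrite !g1E //; exact: injg0.
- by move=> x; rewrite !inE negb_or => /andP[_]; exact: largeC.
exists g; split=> // [x xD|x xD].
  by rewrite gE ?g1E // !inE xD orbT.
have [->|xq] := eqVneq x q; last by apply: gC; rewrite !inE negb_or xq.
by rewrite gE ?setU11 // /g1 eqxx.
Qed.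

(** * Dependent choice of a vertex *)

Section DependentChoice.
Variables (T : finType) (e : rel T) (A : {set T}) (h L : nat).

(** Badness is defined backwards from the tuples with few common neighbours so
    that a tuple that is not bad stays so under all but a proportion [1 / L] of
    its one-vertex extensions; this is what a greedy embedding needs.  On the
    other hand, a bad tuple has at least [(#|U| / L) ^ n] extensions by [n]
    vertices with few common neighbours, so that counting those shows that the
    empty tuple is not bad. *)
Fixpoint bad (U : {set T}) n w : bool :=
  if n is n'.+1 then #|U| <= L * #|[set v in U | bad U n' (v :: w)]|
  else #|common_nbrs e A w| < h.

Fixpoint bad_extensions (U : {set T}) n w : nat :=
  if n is n'.+1 then \sum_(v in U) bad_extensions U n' (v :: w)
  else #|common_nbrs e A w| < h.

Lemma bad_many_extensions U n w :
  bad U n w -> #|U| ^ n <= L ^ n * bad_extensions U n w.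
Proof.
elim: n w => [|n IHn] w /=; first by move=> ->.
move=> hbad; rewrite !expnS -mulnA.
apply: (leq_trans (leq_mul hbad (leqnn _))).
rewrite -mulnA leq_mul2l; apply/orP; right.
rewrite -sum_nat_const big_distrr /=.
rewrite (bigID (mem [set v in U | bad U n (v :: w)]) (mem U)) /=.
apply: leq_trans (leq_addr _ _).
rewrite [leqRHS](eq_bigl (mem [set v in U | bad U n (v :: w)])); last first.
  by move=> v; rewrite !inE; case: (v \in U).
by apply: leq_sum => v; rewrite inE => /andP[_]; exact: IHn.
Qed.

(** Double counting: a tuple with fewer than [h] common neighbours lies in the
    neighbourhoods of fewer than [h] vertices [a]. *)
Lemma sum_bad_extensions (B : {set T}) n w :
  \sum_(a in common_nbrs e A w) bad_extensions (nbrs_in e B a) n w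
    <= #|B| ^ n * h.
Proof.
elim: n w => [|n IHn] w /=.
  rewrite sum_nat_const mul1n; case: ltnP => [/ltnW|_]; by rewrite ?muln1 ?muln0.
rewrite (exchange_big_dep (mem B)) /=; last first.
  by move=> a v _; rewrite inE => /andP[].
rewrite expnS -mulnA -sum_nat_const; apply: leq_sum => v vB.
apply: leq_trans (IHn (v :: w)).
rewrite leq_eqVlt; apply/orP; left; apply/eqP; apply: eq_bigl => a.
by rewrite !inE vB /= andbAC andbA.
Qed.

(** If every [a] failed, its degree into [B] would be small or the number of
    bad tuples in its neighbourhood large; summing over [a], the edge density
    bounds the degrees from below and [sum_bad_extensions] bounds the number of
    bad tuples from above, which contradicts the size of [M]. *)
Lemma dependent_choice (B : {set T}) M D Delta :
  #|A| = M -> #|B| = M -> M ^ 2 <= D * pairs_between e A B ->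
  2 * D * (2 * D * L) ^ Delta * h < M ->
  exists a, M <= 2 * D * #|nbrs_in e B a| /\ ~~ bad (nbrs_in e B a) Delta [::].
Proof.
move=> cA cB dens hM.
apply: contrapT => nex.
(* Both ways of failing are merged into one inequality that can be summed. *)
have key a : a \in A -> 2 * D * #|nbrs_in e B a| * M ^ Delta <=
    M ^ Delta.+1 + 2 * D * M * (2 * D * L) ^ Delta
      * bad_extensions (nbrs_in e B a) Delta [::].
  move=> aA; have [small|large] := ltnP (2 * D * #|nbrs_in e B a|) M.
    rewrite expnS; apply: leq_trans (leq_addr _ _).
    by rewrite leq_mul2r (ltnW small) orbT.
  have /bad_many_extensions hb : bad (nbrs_in e B a) Delta [::].
    by apply: contrapT => /negP nb; apply: nex; exists a.
  apply: leq_trans (leq_addl _ _).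
  have degM : #|nbrs_in e B a| <= M.
    by rewrite -cB; apply/subset_leq_card/subsetP=> b; rewrite inE => /andP[].
  have hP : M ^ Delta
      <= (2 * D * L) ^ Delta * bad_extensions (nbrs_in e B a) Delta [::].
    rewrite expnMn -mulnA; apply: leq_trans (leq_mul (leqnn _) hb).
    by rewrite -expnMn; case: (posnP Delta) => [->|D0]; rewrite ?expn0 ?leq_exp2r.
  apply: leq_trans (leq_mul (leq_mul (leqnn (2 * D)) degM) hP) _.
  by rewrite !mulnA.
have common0 : common_nbrs e A [::] = A by apply/setP => a; rewrite inE andbT.
have := @leq_sum T (index_enum T) (mem A) _ _ key.
rewrite big_split /= sum_nat_const cA -!big_distrr -big_distrl /=.
rewrite -big_distrr /= -/(pairs_between e A B).
have := sum_bad_extensions B Delta [::]; rewrite common0 cB.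
move: (\sum_(a in A) _) (pairs_between e A B) dens => b p dens hb.
have M0 : 0 < M by apply: leq_trans hM.
have P0 : 0 < M ^ Delta by rewrite expn_gt0 M0.
move: ((2 * D * L) ^ Delta) hM => K hM; rewrite expnS mulnA => tot.
have : 2 * (M ^ 2) * M ^ Delta <= (M * M + 2 * D * M * K * h) * M ^ Delta.
  apply: leq_trans (leq_trans (leq_mul _ (leqnn _)) tot) _.
    by rewrite -mulnA leq_mul2l dens.
  by rewrite mulnDl leq_add2l -[leqRHS]mulnA leq_mul2l [h * _]mulnC hb orbT.
rewrite leq_pmul2r // -mulnn mul2n -addnn leq_add2l.
have -> : 2 * D * M * K * h = M * (2 * D * K * h) by lia.
by rewrite leq_pmul2l // leqNgt hM.
Qed.
End DependentChoice.

(** * Bipartite graphs of bounded degree in dense pairs *)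

Section Embedding.
Variables (T : finType) (e : rel T) (A U : {set T}) (h Delta : nat).
Hypothesis Delta_gt0 : 0 < Delta.
Notation bad := (bad e A h (2 * Delta) U).

Lemma good_common_nbrs n w : 0 < #|U| -> ~~ bad n w -> h <= #|common_nbrs e A w|.
Proof.
move=> U0; elim: n w => [|n IHn] w /=; first by rewrite -leqNgt.
move=> good.
have [v vU /IHn hv] : exists2 v, v \in U & ~~ bad n (v :: w).
  apply: contrapT => nex; move/negP: good; apply.
  have -> : [set v in U | bad n (v :: w)] = U.
    apply/setP => v; rewrite inE; case vU: (v \in U) => //=.
    by apply: contrapT => /negP nb; apply: nex; exists v.
  by rewrite leq_pmull // muln_gt0.
apply: leq_trans hv _; apply/subset_leq_card/subsetP => a.
by rewrite !inE /= => /and3P[-> _ ->].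
Qed.

Variables (H : sgraph) (side : H -> bool).
Hypothesis side_bip : forall x y : H, sadj x y -> side x != side y.
Hypothesis degH : max_degree H <= Delta.
Hypothesis good0 : ~~ bad Delta [::].
Hypothesis cardU : 2 * #|H| < #|U|.

(** The order of [ps] is kept, so that embedding one more vertex in front of
    [ps] puts its image in front of the tuple of each of its neighbours. *)
Let nbr_images (g : H -> T) (q : H) ps := [seq g p | p <- ps & sadj q p].

Lemma degree_le (x : H) : #|[set y : H | sadj x y]| <= Delta.
Proof. by apply: leq_trans degH; exact: (leq_bigmax x). Qed.

(** The greedy invariant: the images of the embedded neighbours of [q] form a
    tuple that is not bad.  The next vertex [p] has at most [Delta] neighbours
    [q], each of which forbids at most [#|U| / (2 * Delta)] images, so
    altogether they forbid at most half of [U]. *)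
Lemma embed_first_side (ps : seq H) : uniq ps ->
  exists g : H -> T,
    [/\ {in ps &, injective g}, {in ps, forall p, g p \in U} &
      forall q,
        ~~ bad (Delta - size (nbr_images g q ps)) (nbr_images g q ps)].
Proof.
elim: ps => [_|p ps IHps /= /andP[p_ps ups]].
  have /card_gt0P[v _] : 0 < #|U| by apply: leq_trans cardU.
  by exists (fun=> v); split=> // q; rewrite /= subn0.
have {IHps}[g [injg gU good]] := IHps ups.
pose w q := nbr_images g q ps.
pose X q := [set v in U | bad (Delta - size (w q)).-1 (v :: w q)].
have szw q : sadj q p -> size (w q) < Delta.
  move=> qp; rewrite size_map; apply: leq_trans (degree_le q).
  rewrite -[X in X < _](card_uniqP _) ?filter_uniq //.
  apply/proper_card/properP; split.
    by apply/subsetP => y; rewrite mem_filter inE => /andP[].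
  by exists p; rewrite ?inE // mem_filter (negPf p_ps) andbF.
have cX q : sadj q p -> 2 * Delta * #|X q| <= #|U|.
  move=> qp; have := good q; have := szw q qp.
  rewrite -/(w q) /X -subn_gt0; case: (Delta - _) => // n _ /=.
  by rewrite -ltnNge => /ltnW.
pose N := [set q : H | sadj p q].
pose used := [set v in [seq g x | x <- ps]].
have cused : 2 * #|used| < #|U|.
  apply: leq_ltn_trans cardU; rewrite leq_pmul2l // cardsE.
  apply: leq_trans (card_size _) _; rewrite size_map -(card_uniqP ups).
  exact: max_card.
have cbad : 2 * #|\bigcup_(q in N) X q| <= #|U|.
  rewrite -(leq_pmul2l Delta_gt0) mulnA [Delta * 2]mulnC.
  apply: leq_trans (leq_mul (leqnn _) (card_bigcup_le _ _)) _.
  rewrite big_distrr /=.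
  apply: leq_trans (leq_mul (degree_le p) (leqnn _)).
  rewrite -sum_nat_const; apply: leq_sum => q; rewrite inE sadj_sym.
  exact: cX.
have [v vU] : exists2 v, v \in U & v \notin used :|: \bigcup_(q in N) X q.
  apply/subsetPn/negP => /subset_leq_card; apply/negP; rewrite -ltnNge.
  by apply: leq_ltn_trans (leq_card_setU _ _) _; lia.
rewrite !inE negb_or => /andP[vps vX].
have gE : {in ps, forall x, (if x == p then v else g x) = g x}.
  by move=> x xps; case: eqP => // xp; rewrite -xp xps in p_ps.
exists (fun x => if x == p then v else g x); split.
- move=> x y; rewrite !inE => /orP[/eqP->|xps] /orP[/eqP->|yps] //=.
  + by rewrite eqxx gE // => vg; case/mapP: vps; exists y.
  + by rewrite eqxx gE // => vg; case/mapP: vps; exists x.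
  + by rewrite !gE //; exact: injg.
- by move=> x; rewrite inE => /orP[/eqP->|xps]; rewrite ?eqxx // gE // gU.
move=> q; rewrite /nbr_images /=.
have wE : [seq if x == p then v else g x | x <- ps & sadj q x] = w q.
  by apply/eq_in_map => x; rewrite mem_filter => /andP[_]; exact: gE.
case: ifP => qp; rewrite /= wE ?eqxx; last exact: good.
rewrite subnS; apply/negP => b; case/bigcupP: vX; exists q.
  by rewrite inE sadj_sym.
by rewrite inE vU.
Qed.

(** The candidates for a vertex of the second side are the common neighbours of
    the images of its neighbours; the first side left at least [h] of them. *)
Lemma embed_bipartite : #|H| <= h ->
  exists g : H -> T,
    [/\ injective g, forall x, ~~ side x -> g x \in A &
      forall x y, ~~ side x -> sadj x y -> e (g x) (g y)].
Proof.
move=> Hh.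
have [g0 [injg0 gU good]] := embed_first_side (enum_uniq [pred p | side p]).
pose D := [set p | side p].
pose C q := common_nbrs e A [seq g0 p | p <- enum [pred p | side p] & sadj q p].
have [||g [injg gE gC]] := @injective_extension H T C D g0.
- by move=> x y; rewrite !inE => sx sy; apply: injg0; rewrite mem_enum.
- move=> q _; apply: leq_trans Hh (good_common_nbrs _ (good q)).
  by apply: leq_trans cardU.
exists g; split=> // [x sx|x y sx xy].
  by have := gC x; rewrite !inE sx => /(_ isT)/andP[].
have sy : side y by move: (side_bip xy) sx; case: (side x); case: (side y).
have := gC x; rewrite !inE sx => /(_ isT)/andP[_ /allP]; apply.
rewrite gE ?inE //; apply: map_f.
by rewrite mem_filter xy mem_enum.
Qed.
End Embedding.

(** The sides of [H] are exchanged if necessary, so that the larger one is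
    embedded into [A]. *)
Lemma bipartite_copy_in_dense_pair (T : finType) (e : rel T) (A B : {set T})
    (M D Delta h : nat) (H : sgraph) :
  symmetric e -> 0 < Delta -> bipartite H -> max_degree H <= Delta ->
  #|H| <= h -> #|A| = M -> #|B| = M -> M ^ 2 <= D * pairs_between e A B ->
  2 * D * (4 * D * Delta) ^ Delta * h < M ->
  exists g : H -> T,
    [/\ injective g, forall x y, sadj x y -> e (g x) (g y) &
      #|H| <= 2 * #|g @: [set: H] :&: A|].
Proof.
move=> esym Delta0 [side0 side0P] degH Hh cA cB dens hM.
have [side sideP lside] : exists2 side : H -> bool,
    forall x y : H, sadj x y -> side x != side y &
    #|H| <= 2 * #|[set x | ~~ side x]|.
  have [le1|le2] := leqP #|[set x | side0 x]| #|[set x | ~~ side0 x]|.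
    exists side0 => //; rewrite -(cardsC [set x | side0 x]) mul2n -addnn.
    have -> : ~: [set x | side0 x] = [set x | ~~ side0 x].
      by apply/setP => x; rewrite !inE.
    by rewrite leq_add2r.
  exists (fun x => ~~ side0 x) => [x y /side0P|].
    by case: (side0 x); case: (side0 y).
  have -> : [set x | ~~ ~~ side0 x] = [set x | side0 x].
    by apply/setP => x; rewrite !inE negbK.
  rewrite -(cardsC [set x | side0 x]) mul2n -addnn leq_add2l.
  have -> : ~: [set x | side0 x] = [set x | ~~ side0 x].
    by apply/setP => x; rewrite !inE.
  exact: ltnW.
have D0 : 0 < D.
  by case: D dens hM => [|//]; rewrite mul0n leqn0 expn_eq0 andbT => /eqP->.
have [|a [largeU good]] :=
    @dependent_choice T e A h (2 * Delta) B M D Delta cA cB dens.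
  by rewrite (_ : 2 * D * (2 * Delta) = 4 * D * Delta) //; lia.
have cU : 2 * #|H| < #|nbrs_in e B a|.
  rewrite -(@ltn_pmul2l (2 * D)) ?muln_gt0 //; apply: leq_trans largeU.
  apply: leq_ltn_trans hM; rewrite -[leqRHS]mulnA leq_pmul2l ?muln_gt0 //.
  apply: leq_mul Hh; apply: leq_trans (leq_pexp2l _ Delta0).
    by nia.
  by nia.
have [g [injg gA ge]] := embed_bipartite Delta0 sideP degH good cU Hh.
exists g; split=> // [x y xy|].
  have [sx|sx] := boolP (side x); last exact: ge.
  rewrite esym ge 1?sadj_sym //.
  by have := sideP _ _ xy; rewrite sx; case: (side y).
apply: leq_trans lside _; rewrite leq_pmul2l //.
rewrite -(card_imset _ injg); apply/subset_leq_card/subsetP => y.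
by move=> /imsetP[x]; rewrite inE => sx ->; rewrite inE imset_f // gA.
Qed.

(** * Transversals of sparse families *)

Lemma pairs_between_sub (T : finType) (e : rel T) (A A' B B' : {set T}) :
  A' \subset A -> B' \subset B -> pairs_between e A' B' <= pairs_between e A B.
Proof.
move=> /subsetP sA sB; rewrite [leqRHS](bigID (mem A')) /=.
apply: leq_trans (leq_addr _ _); rewrite [leqRHS](eq_bigl (mem A')); last first.
  by move=> a /=; case aA': (a \in A'); rewrite ?andbF // sA.
apply: leq_sum => a _; apply/subset_leq_card/subsetP => b.
by rewrite !inE => /andP[/(subsetP sB)-> ->].
Qed.

Lemma pairs_between_sym (T : finType) (e : rel T) (A B : {set T}) :
  symmetric e -> pairs_between e A B = pairs_between e B A.
Proof.
move=> esym; rewrite /pairs_between.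
under eq_bigr do rewrite -sum1_card.
under [RHS]eq_bigr do rewrite -sum1_card.
rewrite (exchange_big_dep (mem B)) /=; last first.
  by move=> a b _; rewrite inE => /andP[].
apply: eq_bigr => b bB; apply: eq_bigl => a.
by rewrite !inE bB esym.
Qed.

(** Greedy choice: a typical vertex of the first set is adjacent to at most half
    of the guaranteed size [M / c] of every other set; removing its neighbours
    then doubles [c], while the numbers of pairs can only decrease.  This is
    why sparsity is measured against the fixed number [M ^ 2]. *)
Lemma sparse_transversal (T : finType) (e : rel T) M c D k (Vs : seq {set T}) :
  size Vs = k -> 0 < M -> 0 < c -> 2 * (2 ^ k * c) ^ 2 * k < D ->
  all (fun V : {set T} => M <= c * #|V|) Vs ->
  pairwise (fun V W => D * pairs_between e V W <= M ^ 2) Vs ->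
  exists s, all2 (fun x (V : {set T}) => x \in V) s Vs
            /\ pairwise (fun x y => ~~ e x y) s.
Proof.
move=> szVs M0; elim: k Vs c szVs => [|k IHk] [|V Vs] c //=; first by exists [::].
move=> [szVs] c0 hD /andP[largeV largeVs] /andP[sparseV sparseVs].
pose X W := [set v in V | M < 2 * c * #|nbrs_in e W v|].
have cX W : W \in Vs -> D * #|X W| <= 2 * c * M.
  move=> WVs; rewrite -(leq_pmul2r M0).
  have : M * #|X W| <= 2 * c * pairs_between e V W.
    rewrite mulnC -sum_nat_const big_distrr /=.
    rewrite [leqRHS](bigID (mem (X W))) /=; apply: leq_trans (leq_addr _ _).
    rewrite [leqRHS](eq_bigl (mem (X W))); last first.
      by move=> v; rewrite !inE; case: (v \in V).
    by apply: leq_sum => v; rewrite inE => /andP[_ /ltnW].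
  have := allP sparseV W WVs; rewrite -mulnn; nia.
have [v vV vX] : exists2 v, v \in V & v \notin \bigcup_(W <- Vs) X W.
  apply/subsetPn/negP => /subset_leq_card; apply/negP; rewrite -ltnNge.
  have cU : D * #|\bigcup_(W <- Vs) X W| <= k * (2 * c * M).
    have : {subset Vs <= Vs} by [].
    rewrite -szVs; elim: {-2}Vs => [|W Ws IHWs] sWs.
      by rewrite big_nil cards0 muln0.
    rewrite big_cons; apply: leq_trans (leq_mul (leqnn D) (leq_card_setU _ _)) _.
    rewrite mulnDr mulSn; apply: leq_add; first exact/cX/sWs/mem_head.
    by apply: IHWs => W' W'Ws; apply: sWs; rewrite inE W'Ws orbT.
  have D0 : 0 < D by apply: leq_trans hD.
  have hk : 2 * c ^ 2 * k < D.
    apply: leq_ltn_trans hD; apply: leq_mul => //.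
    rewrite leq_mul2l /= leq_exp2r //.
    by rewrite leq_pmull // expn_gt0.
  rewrite -(ltn_pmul2l D0); apply: leq_ltn_trans cU _.
  rewrite -(ltn_pmul2l c0); apply: (@leq_trans (D * M)); last by nia.
  apply: (@leq_trans ((2 * c ^ 2 * k).+1 * M)); last by rewrite leq_mul2r hk orbT.
  rewrite -mulnn; nia.
have [|||||s [sVs' ps]] := IHk [seq W :\: nbrs_in e W v | W <- Vs] (2 * c).
- by rewrite size_map.
- by rewrite muln_gt0.
- apply: leq_ltn_trans hD; rewrite [2 ^ k.+1]expnS.
  have -> : 2 ^ k * (2 * c) = 2 * 2 ^ k * c by lia.
  exact: leq_mul (leqnn _) (leqnSn _).
- rewrite all_map; apply/allP => W WVs /=.
  have := allP largeVs W WVs; have sW : nbrs_in e W v \subset W.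
    by apply/subsetP => b; rewrite inE => /andP[].
  have : 2 * c * #|nbrs_in e W v| <= M.
    by rewrite leqNgt; apply: contra vX => hW; rewrite (big_rem W) //= !inE vV hW.
  by rewrite cardsD (setIidPr sW); nia.
- rewrite pairwise_map; apply: sub_pairwise sparseVs => W W' /=.
  apply: leq_trans; rewrite leq_mul2l pairs_between_sub ?subsetDl ?orbT //.
have avoid Ws t :
    all2 (fun x (W : {set T}) => x \in W) t [seq W :\: nbrs_in e W v | W <- Ws] ->
    all2 (fun x (W : {set T}) => x \in W) t Ws && all (fun y => ~~ e v y) t.
  elim: Ws t => [|W Ws IHWs] [|x t] //= /andP[+ /IHWs/andP[-> ->]].
  by rewrite !inE => /andP[+ xW]; rewrite xW !andbT.
have /andP[sVs nadj] := avoid _ _ sVs'.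
by exists (v :: s); rewrite /= vV sVs nadj ps.
Qed.

(** * Greedy coverings *)

Section GreedyCover.
Variables (T I : finType) (cov : I -> {set T}) (P : I -> Prop).

(** Every piece that is added covers at least [t] new vertices, whence the bound
    on the number of pieces. *)
Lemma greedy_phase t (W : {set T}) : 0 < t ->
  exists (SS : {set I}) (W' : {set T}),
    [/\ forall S, S \in SS -> P S, W' \subset W,
        W \subset W' :|: \bigcup_(S in SS) cov S,
        #|SS| * t <= #|W| & forall S, P S -> #|cov S :&: W'| < t].
Proof.
move=> t0; move: {2}#|W| (leqnn #|W|) => n; elim: n W => [|n IHn] W leWn;
  (have [[S [PS big]]|nbig] := EM (exists S, P S /\ t <= #|cov S :&: W|); last
    by exists set0, W; split=> [S| | | |S PS];
       rewrite ?inE ?big_set0 ?setU0 ?cards0 // ltnNge;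
       apply/negP => big; apply: nbig; exists S).
  move: big; rewrite leqNgt (leq_trans _ t0) // ltnS.
  by apply: leq_trans (subset_leq_card (subsetIr _ _)) leWn.
have cW : #|W :\: cov S| + t <= #|W|.
  by rewrite -(cardsID (cov S) W) addnC leq_add2r setIC.
have [|SS [W' [PSS sW' cover le max]]] := IHn (W :\: cov S); first lia.
exists (S |: SS), W'; split=> //.
- by move=> S'; rewrite inE => /orP[/set1P->|/PSS].
- exact: subset_trans sW' (subsetDl _ _).
- apply/subsetP => x xW; rewrite inE bigcup_setU inE big_set1.
  have [xS|xS] := boolP (x \in cov S); first by rewrite orbT.
  have := subsetP cover x; rewrite !inE xS xW => /(_ isT)/orP[->|->] //.
  by rewrite !orbT.
- apply: leq_trans cW; apply: leq_trans (leq_mul (leq_card_setU _ _) (leqnn t)) _.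
  by rewrite cards1 mulnDl mul1n addnC leq_add2r.
Qed.

(** Each scale costs at most [c * a] pieces: the phase with threshold
    [a ^ j.+1] starts from at most [c * a ^ j.+2] vertices. *)
Lemma multiscale_cover c a j (W : {set T}) : 0 < a ->
  (forall x, exists2 S, P S & x \in cov S) -> #|W| <= c * a ^ j.+1 ->
  (exists SS : {set I}, [/\ forall S, S \in SS -> P S,
      W \subset \bigcup_(S in SS) cov S & #|SS| <= j.+1 * (c * a)]) \/
  (exists (i : 'I_j) (W' : {set T}), c * a ^ i.+1 < #|W'| /\
      forall S, P S -> #|cov S :&: W'| < a ^ i.+1).
Proof.
move=> a0 covP; elim: j W => [|j IHj] W leW.
  have {}covP x : exists S, P S /\ x \in cov S by case: (covP x) => S; exists S.
  left; have [f fP] := choice covP.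
  exists (f @: W); split.
  - by move=> S /imsetP[x _ ->]; case: (fP x).
  - apply/subsetP => x xW; apply/bigcupP; exists (f x); first exact: imset_f.
    by case: (fP x).
  - by apply: leq_trans (leq_imset_card _ _) _; rewrite mul1n.
have aj0 : 0 < a ^ j.+1 by rewrite expn_gt0 a0.
have [SS [W' [PSS sW' cover le max]]] := greedy_phase W aj0.
have [small|large] := leqP #|W'| (c * a ^ j.+1); last first.
  by right; exists ord_max, W'.
case: (IHj W' small) => [[SS' [PSS' cover' le']]|[i [W'' [large stuck]]]].
  left; exists (SS :|: SS'); split.
  - by move=> S; rewrite inE => /orP[/PSS|/PSS'].
  - apply: subset_trans cover _; rewrite bigcup_setU setUC.
    exact: setUS.
  apply: leq_trans (leq_card_setU _ _) _; rewrite mulSn leq_add //.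
  rewrite -(leq_pmul2r aj0); apply: leq_trans le (leq_trans leW _).
  by rewrite [in leqLHS]expnS mulnA.
by right; exists (widen_ord (leqnSn j) i), W''.
Qed.

End GreedyCover.

(** * Monochromatic pieces *)

Section Pieces.
Variables (r : nat) (G : sgraph) (phi : {set G} -> 'I_r) (F : sgraph -> Prop).

(** A piece is built with one colour of the allowed set [Sc], so that a union of
    pieces uses only colours of [Sc]; a piece without edges may take any of
    them. *)
Definition piece (Sc : {set 'I_r}) (S : subgraph_data G) : Prop :=
  [/\ is_subgraph S,
      exists2 c, c \in Sc & forall e, e \in S.2 -> phi e = c &
      exists2 H, F H & isomorphic_to_subgraph H S].

Definition colour_adj (c : 'I_r) : rel G :=
  fun x y => sadj x y && (phi [set x; y] == c).

Lemma colour_adj_sym c : symmetric (colour_adj c).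
Proof. by move=> x y; rewrite /colour_adj sadj_sym setUC. Qed.

Lemma mem_edges (H : sgraph) (x y : H) : ([set x; y] \in edges H) = sadj x y.
Proof.
apply/imsetP/idP => [[[u v]]|xy]; last by exists (x, y).
rewrite inE /= => uv eq.
have /set2P u_xy : u \in [set x; y] by rewrite eq set21.
have /set2P v_xy : v \in [set x; y] by rewrite eq set22.
by case: u_xy uv => ->; case: v_xy => ->; rewrite ?sadj_irr // sadj_sym.
Qed.

Lemma copy_piece (Sc : {set 'I_r}) c (H : sgraph) (g : H -> G) :
  F H -> c \in Sc -> injective g ->
  (forall x y, sadj x y -> colour_adj c (g x) (g y)) ->
  piece Sc (g @: [set: H], [set g @: (e : {set H}) | e in edges H]).
Proof.
move=> FH cSc injg gc; split=> /=.
- apply/andP; split=> /=.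
    apply/subsetP => _ /imsetP[_ /imsetP[[x y] + ->] ->].
    rewrite inE /= => /gc/andP[xy _].
    by rewrite imsetU1 imset_set1 mem_edges.
  apply/forall_inP => _ /imsetP[e _ ->]; apply: imsetS; exact: subsetT.
- exists c => // _ /imsetP[_ /imsetP[[x y] + ->] ->].
  by rewrite inE /= imsetU1 imset_set1 => /gc/andP[_ /eqP].
exists H => //; exists g; split=> // x y.
rewrite -mem_edges -!imset_set1 -imsetU.
by rewrite mem_imset //; exact: imset_inj.
Qed.

Lemma singleton_piece (Sc : {set 'I_r}) c (x : G) :
  (exists2 H, F H & #|H| = 1) -> c \in Sc ->
  exists2 S, piece Sc S & x \in S.1.
Proof.
move=> [H FH H1] cSc; have /fintype1P[z zP] : #|H| == 1 by rewrite H1.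
exists ((fun=> x) @: [set: H], [set (fun=> x) @: (e : {set H}) | e in edges H]).
  apply: (@copy_piece _ c) => // [u v _|u v]; first by rewrite (zP u) (zP v).
  by rewrite (zP u) (zP v) sadj_irr.
by apply/imsetP; exists z.
Qed.

Lemma pieces_covering (Sc : {set 'I_r}) (SS : {set subgraph_data G}) :
  (forall S, S \in SS -> piece Sc S) ->
  [set: G] \subset \bigcup_(S in SS) S.1 ->
  mono_covering phi F SS /\ #|used_colours phi SS| <= #|Sc|.
Proof.
move=> SSP cover; split; first split.
- move=> S /SSP[subS [c _ cS] FS]; split=> // e e' eS e'S.
  by rewrite !cS.
- by move=> x; have /bigcupP[S] := subsetP cover x (in_setT x); exists S.
apply/subset_leq_card/subsetP => _ /imsetP[e /bigcupP[S SSS eS] ->].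
have [_ [c cSc cS] _] := SSP S SSS.
by rewrite cS.
Qed.

End Pieces.

(** * Kneser hypergraphs *)

Section HyperChromatic.
Variables (T : finType) (E : {set {set T}}).

Lemma hyper_chromatic_le k : hyper_colourable E k -> hyper_chromatic E <= k.
Proof.
have le_card : hyper_chromatic E <= #|T|.
  rewrite /hyper_chromatic; apply: (big_ind (leq^~ #|T|)) => // [x y lex _|k' _].
    by rewrite geq_min lex.
  by rewrite -ltnS ltn_ord.
have [kT|Tk] := leqP k #|T|; last by move=> _; exact: leq_trans (ltnW Tk).
move=> colk; pose k' : 'I_#|T|.+1 := Ordinal (kT : k < #|T|.+1).
rewrite /hyper_chromatic.
have : k' \in index_enum 'I_#|T|.+1 by rewrite mem_index_enum.
elim: (index_enum _) => // i t IHt; rewrite inE big_cons => /orP[/eqP<-|/IHt le].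
  by rewrite colk geq_minl.
by case: ifP => // _; rewrite geq_min le orbT.
Qed.

Lemma hyper_chromatic_gt0 : 0 < #|T| -> 0 < hyper_chromatic E.
Proof.
move=> T0; rewrite /hyper_chromatic.
apply: (big_ind (leq 1)) => // [x y x0 y0|k /existsP[f _]].
  by rewrite leq_min x0.
by have /card_gt0P[x _] := T0; apply: leq_trans (ltn_ord (f x)).
Qed.

End HyperChromatic.

Lemma kneser_vertex_gt0 r m : m <= r -> 0 < #|kneser_vertex r m|.
Proof.
move=> mr; have : 0 < #|[set X : {set 'I_r} | #|X| == m]|.
  by rewrite card_draws card_ord bin_gt0.
move=> /card_gt0P[X]; rewrite inE => cX.
by apply/card_gt0P; exists (Sub X cX : kneser_vertex r m).
Qed.

(** * Coverings with few colours *)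

Section FewColours.
Variables (r s alpha Delta E : nat).

(** The inverse of the density guaranteed for one colour: the second factor is
    the bound of [sparse_transversal] for [alpha.+1] sets and [c = 1], the
    factor [r] selects a colour, and the factor [2] compensates for pairs of
    equal vertices. *)
Definition pair_density := 2 * r * (2 * (2 ^ alpha.+1) ^ 2 * alpha.+1).+1.

(** How much larger than a scale [m] a stuck set has to be: this is the bound of
    [bipartite_copy_in_dense_pair] for a graph with at most [E * (2 * m)]
    vertices, divided by [m].  Such a graph has at least [2 * m] vertices, and
    its larger side at least [m]. *)
Definition stuck_ratio :=
  (2 * pair_density * (4 * pair_density * Delta) ^ Delta * (2 * E)).+1.

Hypotheses (s_gt0 : 0 < s) (s_lt_r : s < r).
Hypotheses (Delta_gt0 : 0 < Delta) (E_gt0 : 0 < E).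

Variable F : sgraph -> Prop.
Hypothesis F_bounded : bounded_family Delta F.
Hypothesis F_bipartite : forall m, 0 < m -> exists H : sgraph,
  [/\ F H, bipartite H, m <= #|H| & #|H| <= E * m].
Hypothesis F_point : exists2 H, F H & #|H| = 1.

Variable G : sgraph.
Hypothesis G_alpha : independence_number G <= alpha.
Variable phi : {set G} -> 'I_r.

Let piece := piece phi F.
Let M m := stuck_ratio * m.

Lemma pair_density_gt0 : 0 < pair_density.
Proof. by rewrite !muln_gt0 /= andbT (leq_ltn_trans (leq0n s)). Qed.

Lemma dense_colour_piece (Sc : {set 'I_r}) c m (A B : {set G}) :
  0 < m -> c \in Sc -> #|A| = M m -> #|B| = M m ->
  M m ^ 2 <= pair_density * pairs_between (colour_adj phi c) A B ->
  exists2 S, piece Sc S & m <= #|S.1 :&: A|.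
Proof.
move=> m0 cSc cA cB dens.
have [|H [FH bipH lowH highH]] := F_bipartite (_ : 0 < 2 * m).
  by rewrite muln_gt0 m0.
have [|g [injg gc gA]] := bipartite_copy_in_dense_pair (colour_adj_sym phi c)
    Delta_gt0 bipH (F_bounded FH) highH cA cB dens.
  rewrite /M /stuck_ratio; move: pair_density ((4 * _ * _) ^ _) => D K.
  have -> : 2 * D * K * (E * (2 * m)) = 2 * D * K * (2 * E) * m by lia.
  by rewrite ltn_pmul2r.
exists (g @: [set: H], [set g @: (e : {set H}) | e in edges H]).
  exact: copy_piece gc.
by rewrite -(@leq_pmul2l 2) //; apply: leq_trans gA.
Qed.

Lemma pairs_between_colours (A B : {set G}) :
  pairs_between (fun x y => (x == y) || sadj x y) A B
    <= #|A| + \sum_c pairs_between (colour_adj phi c) A B.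
Proof.
rewrite [X in _ + X]exchange_big /= -sum1_card -big_split /=.
apply: leq_sum => a _.
apply: (@leq_trans #|a |: \bigcup_c nbrs_in (colour_adj phi c) B a|).
  apply/subset_leq_card/subsetP => b; rewrite !inE.
  case/andP=> bB /orP[/eqP->|ab]; first by rewrite eqxx.
  apply/orP; right; apply/bigcupP; exists (phi [set a; b]) => //.
  by rewrite inE bB /colour_adj ab /=.
apply: leq_trans (leq_card_setU _ _) _; rewrite cards1 leq_add2l.
exact: card_bigcup_le.
Qed.

(** Otherwise all colours are sparse between any two of the stuck sets, so that
    the stuck sets have an independent transversal, which is too large for
    [G]. *)
Lemma no_stuck_hyperedge m (e : {set kneser_vertex r (r - s)})
    (W : kneser_vertex r (r - s) -> {set G}) :
  0 < m -> e \in kneser_hyperedges alpha.+1 r (r - s) ->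
  (forall X, X \in e -> M m < #|W X|) ->
  (forall X, X \in e -> forall S, piece (~: val X) S -> #|S.1 :&: W X| < m) ->
  False.
Proof.
move=> m0; rewrite inE => /andP[/eqP card_e /forall_inP disjE] large stuck.
have M0 : 0 < M m by rewrite muln_gt0.
have ex_V X : exists V : {set G}, X \in e -> V \subset W X /\ #|V| = M m.
  have [Xe|] := boolP (X \in e); last by exists set0.
  by have [V sV cV] := subset_of_card (ltnW (large X Xe)); exists V.
have [V VP] := choice ex_V.
have stuckV X S : X \in e -> piece (~: val X) S -> #|S.1 :&: V X| < m.
  move=> Xe pS; apply: leq_ltn_trans (stuck X Xe S pS).
  by apply/subset_leq_card/setIS; case: (VP X Xe).
have sparse X Y c : X \in e -> Y \in e -> X != Y ->
    pair_density * pairs_between (colour_adj phi c) (V X) (V Y) <= M m ^ 2.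
  move=> Xe Ye XY; rewrite leqNgt; apply/negP => /ltnW dens.
  have [[_ cX] [_ cY]] := (VP X Xe, VP Y Ye).
  (* The colour [c] avoids [X] or [Y], as these are disjoint. *)
  have [cX'|cX'] := boolP (c \in val X).
    have cYn : c \in ~: val Y.
      rewrite inE; apply/negP => cY'.
      have /forall_inP/(_ Y Ye)/implyP/(_ XY) := disjE X Xe.
      by move=> /pred0P/(_ c); rewrite /= cX' cY'.
    rewrite (pairs_between_sym _ _ (colour_adj_sym phi c)) in dens.
    have [S pS] := dense_colour_piece m0 cYn cY cX dens.
    by rewrite leqNgt stuckV.
  have cXn : c \in ~: val X by rewrite inE.
  have [S pS] := dense_colour_piece m0 cXn cX cY dens.
  by rewrite leqNgt stuckV.
(* The stuck sets may overlap; counting equal vertices as adjacent makes the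
   vertices of the transversal distinct. *)
pose R := fun x y : G => (x == y) || sadj x y.
pose D0 := (2 * (2 ^ alpha.+1) ^ 2 * alpha.+1).+1.
have [||||||t [tV tR]] :=
    @sparse_transversal G R (M m) 1 D0 alpha.+1 [seq V X | X <- enum e].
- by rewrite size_map -cardE card_e.
- exact: M0.
- by [].
- by rewrite muln1.
- by apply/allP => _ /mapP[X + ->]; rewrite mem_enum mul1n => /VP[_ ->].
- rewrite pairwise_map.
  apply: (@sub_in_pairwise _ (mem e) (fun X Y => X != Y)); last 2 first.
  + by apply/allP => X; rewrite mem_enum.
  + by rewrite -uniq_pairwise enum_uniq.
  move=> X Y Xe Ye XY /=.
  apply: leq_trans (leq_mul (leqnn D0) (pairs_between_colours _ _)) _.
  have [_ ->] := VP X Xe.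
  have r0 : 0 < r by apply: leq_ltn_trans s_lt_r.
  have sum_sparse :
      2 * D0 * \sum_c pairs_between (colour_adj phi c) (V X) (V Y) <= M m ^ 2.
    rewrite -(leq_pmul2l r0) mulnA mulnCA mulnA -[2 * r * D0]/pair_density.
    rewrite big_distrr /= -[X in X * _ ^ 2]card_ord -sum_nat_const.
    by apply: leq_sum => c _; exact: sparse.
  have D0M : 2 * D0 <= M m.
    apply: leq_trans (leq_pmulr _ m0); apply: leqW.
    apply: (@leq_trans pair_density); first by rewrite /pair_density -/D0; nia.
    move: pair_density pair_density_gt0 => D D_gt0.
    have K_gt0 : 0 < (4 * D * Delta) ^ Delta.
      by rewrite expn_gt0 !muln_gt0 D_gt0 Delta_gt0.
    move: (_ ^ _) K_gt0 => K K_gt0.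
    have -> : 2 * D * K * (2 * E) = D * (4 * (K * E)) by lia.
    by rewrite leq_pmulr // !muln_gt0 K_gt0.
  move: sum_sparse D0M; rewrite -mulnn.
  by move: (M m) D0 (\sum_c _) => N D p; nia.
have szt : size t = alpha.+1.
  by move: tV; rewrite all2E size_map -cardE card_e => /andP[/eqP].
have ut : uniq t.
  apply: (pairwise_uniq _ tR) => x /=; by rewrite /R eqxx.
have tind : independent [set x in t].
  have tN : pairwise (fun x y : G => ~~ sadj x y) t.
    by apply: sub_pairwise tR => x y /=; rewrite negb_or => /andP[].
  rewrite pairwise_all2rel in tN; first last.
  - by move=> x y; rewrite /= sadj_sym.
  - by move=> x; rewrite /= sadj_irr.
  apply/forall_inP => x; rewrite inE => xt.
  apply/forall_inP => y; rewrite inE => yt.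
  by move/allrelP: tN => /(_ x y xt yt).
have : alpha < independence_number G.
  rewrite -szt -(card_uniqP ut) -cardsE /independence_number.
  exact: (@leq_bigmax_cond _ (@independent G) (fun A : {set G} => #|A|) _ tind).
by rewrite ltnNge G_alpha.
Qed.

(** The scales at which the colour sets are stuck would be a proper colouring of
    the Kneser hypergraph with fewer colours than its chromatic number. *)
Lemma few_colours_covering a :
  0 < a -> #|G| <= a ^ kneser_chromatic alpha.+1 r (r - s) ->
  exists SS : {set subgraph_data G},
    [/\ mono_covering phi F SS,
        #|SS| <= kneser_chromatic alpha.+1 r (r - s) * (stuck_ratio * a) &
        #|used_colours phi SS| <= s].
Proof.
move=> a0; have [j chiE] : exists j, kneser_chromatic alpha.+1 r (r - s) = j.+1.
  have : 0 < kneser_chromatic alpha.+1 r (r - s).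
    by apply/hyper_chromatic_gt0/kneser_vertex_gt0/leq_subr.
  by case: (kneser_chromatic _ _ _) => // j; exists j.
rewrite chiE => cG.
have cardS (X : kneser_vertex r (r - s)) : #|~: val X| = s.
  have /eqP cX := valP X.
  by have := cardsC (val X); rewrite cX card_ord; lia.
have pieces_cover (X : kneser_vertex r (r - s)) x :
    exists2 S, piece (~: val X) S & x \in S.1.
  have /card_gt0P[c cX] : 0 < #|~: val X| by rewrite cardS.
  exact: singleton_piece cX.
have leG : #|[set: G]| <= stuck_ratio * a ^ j.+1.
  by rewrite cardsT; apply: leq_trans cG (leq_pmull _ _).
apply: contrapT => nocover.
have stuck (X : kneser_vertex r (r - s)) : exists iW : 'I_j * {set G},
    stuck_ratio * a ^ iW.1.+1 < #|iW.2| /\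
    forall S, piece (~: val X) S -> #|S.1 :&: iW.2| < a ^ iW.1.+1.
  have [[SS [SSP cover le]]|[i [W iW]]] :=
      multiscale_cover a0 (pieces_cover X) leG.
    have [cov] := pieces_covering SSP cover; rewrite cardS => used.
    by case: nocover; exists SS.
  by exists (i, W).
have [f fP] := choice stuck.
have : ~~ hyper_colourable (kneser_hyperedges alpha.+1 r (r - s)) j.
  apply/negP => /hyper_chromatic_le; rewrite -/(kneser_chromatic _ _ _) chiE.
  by rewrite ltnn.
rewrite negb_exists => /forallP/(_ [ffun X => (f X).1]).
case/forall_inPn => e eE; rewrite negbK => /forall_inP mono.
have /card_gt0P[X0 X0e] : 0 < #|e| by move: eE; rewrite inE => /andP[/eqP-> _].
have scale X : X \in e -> (f X).1 = (f X0).1.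
  by move=> Xe; have /forall_inP/(_ X0 X0e)/eqP := mono X Xe; rewrite !ffunE.
apply: (@no_stuck_hyperedge (a ^ (f X0).1.+1) e (fun X => (f X).2)) => //.
- by rewrite expn_gt0 a0.
- by move=> X Xe; rewrite /M -(scale X Xe); case: (fP X).
- by move=> X Xe; rewrite -(scale X Xe); case: (fP X).
Qed.

End FewColours.

Local Open Scope ring_scope.

(** * Covering numbers *)

(** The supremum ranges over a nonempty set because of the complete graph. *)
Lemma cover_num_max_ge0 (R : realType) r s alpha n F :
  (0 < alpha)%N -> (0 <= cover_num_max R r s alpha n F)%E.
Proof.
move=> alpha0.
pose K := @SGraph 'I_n (fun x y => x != y) (fun x y => congr1 negb (eq_sym x y))
  (fun x => congr1 negb (eqxx x)).
apply: (@le_trans _ _ (cover_num R r s K F)).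
  by apply: le_ereal_inf_tmp => _ [k _ <-]; rewrite lee_fin.
apply: ereal_sup_ubound; exists K; split => //=; first exact: card_ord.
apply/bigmax_leqP => A /forall_inP indA; apply: leq_trans alpha0.
rewrite leqNgt; apply/negP => /card_gt1P[x [y [xA yA xy]]].
by have /forall_inP/(_ y yA) := indA x xA; rewrite /= xy.
Qed.

(** Rounding up at most doubles the root, which is at least [1]. *)
Lemma root_ceil (R : realType) (n k : nat) : (0 < n)%N -> (0 < k)%N ->
  exists a : nat,
    [/\ (0 < a)%N, (n <= a ^ k)%N & a%:R <= 2 * n%:R `^ (k%:R^-1) :> R].
Proof.
move=> n0 k0.
have ex : exists a, (n <= a ^ k)%N.
  by exists n; case: k k0 => // k _; rewrite expnS leq_pmulr // expn_gt0 n0.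
case: (ex_minnP ex) => a na amin.
have a0 : (0 < a)%N.
  by rewrite lt0n; apply: contraTneq na => ->; rewrite exp0n // -ltnNge.
exists a; split=> //.
have pow1 : 1 <= n%:R `^ (k%:R^-1) :> R.
  apply: (@le_trans _ _ (1 `^ (k%:R^-1))); first by rewrite powR1.
  by apply: ge0_ler_powR; rewrite ?nnegrE ?invr_ge0 ?ler1n.
have powa : a.-1%:R <= n%:R `^ (k%:R^-1) :> R.
  have lt_n : (a.-1 ^ k <= n)%N.
    by rewrite leqNgt; apply/negP => /ltnW/amin; rewrite -ltnS prednK // ltnn.
  have -> : a.-1%:R = (a.-1 ^ k)%:R `^ (k%:R^-1) :> R.
    rewrite natrX -powR_mulrn // -powRrM mulfV ?powRr1 //.
    by rewrite pnatr_eq0 -lt0n.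
  apply: ge0_ler_powR; rewrite ?nnegrE // ?invr_ge0 //.
  by rewrite ler_nat.
by rewrite -(prednK a0) -addn1 natrD mulr_natl mulr2n lerD.
Qed.

Theorem theorem2 (R : realType) (r s alpha Delta : nat) (eps : R)
    (hs : (0 < s)%N) (hrs : (s < r)%N) (halpha : (0 < alpha)%N)
    (hDelta : (0 < Delta)%N) (heps : 0 < eps) :
  exists C : R, 0 < C /\
    forall F : sgraph -> Prop,
      bounded_family Delta F ->
      (forall i : nat, (1 <= i)%N ->
         exists H : sgraph,
           [/\ F H, bipartite H, eps * i%:R <= #|H|%:R & (#|H| <= i)%N]) ->
      forall n : nat,
        (cover_num_max R r s alpha n F <=
          (C * n%:R `^ ((kneser_chromatic alpha.+1 r (r - s))%:R^-1))%:E
          + cover_num_max R r r alpha n F)%E.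
Proof.
pose chi := kneser_chromatic alpha.+1 r (r - s).
have chi0 : (0 < chi)%N by apply/hyper_chromatic_gt0/kneser_vertex_gt0/leq_subr.
(* The member of [F] chosen for [i = E * m] has at least [m] vertices. *)
have [E E0 epsE] : exists2 E : nat, (0 < E)%N & 1 <= eps * E%:R.
  have lt_bound := archi_boundP (ltW (_ : 0 < eps^-1)).
  exists (Num.bound eps^-1).
    by rewrite -(ltr0n R); apply: lt_trans (lt_bound _); rewrite invr_gt0.
  by rewrite -ler_pdivrMl // mulr1; apply/ltW/lt_bound; rewrite invr_gt0.
pose c := (chi * stuck_ratio r alpha Delta E)%N.
have c0 : (0 < c)%N by rewrite muln_gt0 chi0.
exists (2 * c%:R); split; first by rewrite mulr_gt0 ?ltr0n.
move=> F Fbounded Fbip n.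
have Flarge m : (0 < m)%N -> exists H : sgraph,
    [/\ F H, bipartite H, (m <= #|H|)%N & (#|H| <= E * m)%N].
  move=> m0; have [|H [FH bipH low high]] := Fbip (E * m)%N.
    by rewrite muln_gt0 E0.
  exists H; split=> //; rewrite -(ler_nat R); apply: le_trans low.
  by rewrite natrM mulrA ler_peMl.
have Fpoint : exists2 H, F H & #|H| = 1%N.
  have [H [FH _ low high]] := Fbip 1%N isT; exists H => //.
  apply/eqP; rewrite eqn_leq high -(ltr0n R).
  by apply: lt_le_trans low; rewrite mulr1.
apply: (@le_trans _ _ (2 * c%:R * n%:R `^ (chi%:R^-1))%:E); last first.
  by rewrite leeDl // cover_num_max_ge0.
apply: ge_ereal_sup => _ [G [cG alphaG ->]].
have [n0|n0] := posnP n.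
  rewrite n0 powR0 ?mulr0; last by rewrite invr_eq0 pnatr_eq0 -lt0n.
  apply: ereal_inf_lbound; exists 0%N => // phi; exists set0.
  have noG (x : G) : False by have := max_card (pred1 x); rewrite cG n0 card1.
  split; last by rewrite /used_colours big_set0 imset0 cards0.
    by split=> [S|x]; [rewrite inE | case: (noG x)].
  by rewrite cards0.
have [a [a0 na aR]] := root_ceil R n0 chi0.
apply: (@le_trans _ _ (c * a)%:R%:E); last first.
  by rewrite lee_fin natrM [2 * _]mulrC -mulrA ler_wpM2l.
apply: ereal_inf_lbound; exists (c * a)%N => // phi.
have := few_colours_covering hs hrs hDelta E0 Fbounded Flarge Fpoint alphaG
  phi a0.
by rewrite cG mulnA; exact.
Qed.
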